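(* Let $\Phi$ be a set of finite-rank-free-by-1 abelian groups and let $(\mathfrak{F},\mathfrak{C})$ be the cotorsion theory cogenerated by $\Phi$. Then $(\mathfrak{F},\mathfrak{C})$ has enough projectives and enough injectives.
   Context: Work in the category of abelian groups. For classes $\mathfrak{X},\mathfrak{Y}$, write $\mathfrak{X}\perp\mathfrak{Y}$ if $\mathrm{Ext}(X,Y)=0$ for all $X\in\mathfrak{X},Y\in\mathfrak{Y}$; $\mathfrak{X}^\perp$ is the class of all $Y$ with $\mathrm{Ext}(X,Y)=0$ for all $X\in\mathfrak{X}$, and ${}^\perp\mathfrak{X}$ the class of all $Y$ with $\mathrm{Ext}(Y,X)=0$ for all $X\in\mathfrak{X}$. A cotorsion theory is a pair $(\mathfrak{F},\mathfrak{C})$ with $\mathfrak{C}=\mathfrak{F}^\perp$ and $\mathfrak{F}={}^\perp\mathfrak{C}$; the cotorsion theory cogenerated by $\mathfrak{X}$ is $({}^\perp(\mathfrak{X}^\perp),\mathfrak{X}^\perp)$. It has enough injectives if every group $G$ admits a short exact sequence $0\to G\to C\to F\to0$ with $C\in\mathfrak{C},F\in\mathfrak{F}$, and enough projectives if every $G$ admits $0\to C\to F\to G\to0$ with $C\in\mathfrak{C},F\in\mathfrak{F}$. Let $n<\omega$. Let $B$ be the free abelian group with basis $\{x_i:i<n\}\cup\{y_m:m\in\omega\}$, let $p_m\in\mathbb{Z}\setminus\{0\}$ and $k_{im}\in\mathbb{Z}$, and let $N$ be the subgroup generated by $y_{m+1}p_m-y_m-\sum_{i<n}x_ik_{im}$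 $(m\in\omega)$. A group $G'$ is finite-rank-free-by-1 ($n$-free-by-1) if $G'\cong B/N$ for such data, $G'$ is not free, and every subgroup of $G'$ of rank $\le n$ is free. *)

(* Defs.v *)
From HB Require Import structures.
From mathcomp Require Import all_boot all_order all_algebra.
Set Implicit Arguments. Unset Strict Implicit. Unset Printing Implicit Defensive.
Import Order.TTheory GRing.Theory Num.Theory.
Local Open Scope ring_scope.

Definition hom (A B : zmodType) (f : A -> B) : Prop :=
  forall x y, f (x - y) = f x - f y.

Definition ses (A E C : zmodType) (i : A -> E) (q : E -> C) : Prop :=
  [/\ hom i, hom q, injective i, (forall c, exists e, q e = c)
    & (forall e, q e = 0 <-> exists a, i a = e)].

Definition Ext0 (X Y : zmodType) : Prop :=
  forall (E : zmodType) (i : Y -> E) (q : E -> X), ses i q ->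
    exists s : X -> E, hom s /\ forall x, q (s x) = x.

Definition gclass := zmodType -> Prop.

Definition rperp (C : gclass) : gclass := fun Y => forall X, C X -> Ext0 X Y.
Definition lperp (C : gclass) : gclass := fun X => forall Y, C Y -> Ext0 X Y.

Definition cogenF (X : gclass) : gclass := lperp (rperp X).
Definition cogenC (X : gclass) : gclass := rperp X.

Definition enough_injectives (F C : gclass) : Prop :=
  forall G : zmodType, exists (Cg Fg : zmodType) (i : G -> Cg) (q : Cg -> Fg),
    ses i q /\ C Cg /\ F Fg.

Definition enough_projectives (F C : gclass) : Prop :=
  forall G : zmodType, exists (Cg Fg : zmodType) (i : Cg -> Fg) (q : Fg -> G),
    ses i q /\ C Cg /\ F Fg.

Section Lin.
Variable G : zmodType.

Definition subgroup (H : G -> Prop) : Prop :=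
  H 0 /\ forall x y, H x -> H y -> H (x - y).

Definition zindep (s : seq G) : Prop :=
  forall c : nat -> int, \sum_(j < size s) s`_j *~ c j = 0 ->
    forall j, (j < size s)%N -> c j = 0.

Definition zbasis (H S : G -> Prop) : Prop :=
  [/\ (forall x, S x -> H x),
      (forall s : seq G, uniq s -> (forall x, x \in s -> S x) -> zindep s)
    & (forall g, H g -> exists (s : seq G) (c : nat -> int),
          (forall x, x \in s -> S x) /\ g = \sum_(j < size s) s`_j *~ c j)].

Definition free_on (H : G -> Prop) : Prop := exists S, zbasis H S.

Definition free_group : Prop := free_on (fun _ => True).

Definition rank_le (r : nat) (H : G -> Prop) : Prop :=
  forall s : seq G, uniq s -> (forall x, x \in s -> H x) -> zindep s ->
    (size s <= r)%N.

(* Elements of B are written  sum_i c_i x_i + sum_{j<M} d_j y_j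
   (d vanishing from M on); a : images of x_i, b : images of y_m. *)
Variables (n : nat) (p : nat -> int) (k : 'I_n -> nat -> int).

Definition evalB (a : 'I_n -> G) (b : nat -> G) (c : 'I_n -> int)
  (d : nat -> int) (M : nat) : G :=
  \sum_(i < n) a i *~ c i + \sum_(j < M) b j *~ d j.

(* (c,d) lies in N = < y_{m+1} p_m - y_m - sum_i x_i k_im : m in omega > *)
Definition inN (c : 'I_n -> int) (d : nat -> int) : Prop :=
  exists (e : nat -> int) (L : nat), (forall m, (L <= m)%N -> e m = 0) /\
    (forall i, c i = - \sum_(m < L) e m * k i m) /\
    (forall j, d j = (if j is j'.+1 then e j' * p j' else 0) - e j).

(* G is isomorphic to B/N: there is a surjective homomorphism B -> G
   (determined by the images a, b of the basis) whose kernel is N *)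
Definition presented : Prop :=
  exists (a : 'I_n -> G) (b : nat -> G),
    (forall g, exists c d M, (forall j, (M <= j)%N -> d j = 0) /\ evalB a b c d M = g) /\
    (forall c d M, (forall j, (M <= j)%N -> d j = 0) ->
        (evalB a b c d M = 0 <-> inN c d)).
End Lin.

Definition fr_free_by_1 (G : zmodType) : Prop :=
  exists (n : nat) (p : nat -> int) (k : 'I_n -> nat -> int),
    [/\ (forall m, p m != 0), presented G p k, ~ free_group G
      & forall H : G -> Prop, subgroup H -> rank_le n H -> free_on H].

(* Main.v *)
(** For a presentation of [G] by free generators [u_j] and independent relators
    [r_m], the condition [Ext(G, Y) = 0] says that every system of equations
    [sum_j u_j * r_mj = z_m] with right-hand sides in [Y] is solvable in [Y].

    To cover [G] by a group [P] in the left class with kernel in the right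
    class, take well-founded terms over [G] with a node "a solution of the
    system with right-hand side [z]" for each sequence [z] of terms, modulo the
    abelian group laws and the equations attached to those [z] that vanish in
    [G].  Such a term algebra is closed under solutions without any transfinite
    iteration, and an extension of [P] by a group of the right class is split by
    recursion on terms.

    Enough injectives follow by pulling back such a cover of [D / G], where [D]
    is a divisible hull of [G]: systems with nonzero [p_m] are solvable in [D]. *)
From HB Require Import structures.
From mathcomp Require Import all_boot all_order all_algebra.
From mathcomp Require Import boolp functions.
Require Import Defs.
Set Implicit Arguments. Unset Strict Implicit. Unset Printing Implicit Defensive.
Import Order.TTheory GRing.Theory Num.Theory.
Local Open Scope ring_scope.

(** * Homomorphisms, quotients and kernels *)

Section Hom.
Variables (A B : zmodType) (f : A -> B).
Hypothesis hf : hom f.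

Lemma hom0 : f 0 = 0.
Proof. by rewrite -(subrr 0) hf subrr. Qed.

Lemma homN x : f (- x) = - f x.
Proof. by rewrite -sub0r hf hom0 sub0r. Qed.

Lemma homD x y : f (x + y) = f x + f y.
Proof. by rewrite -{1}(opprK y) hf homN opprK. Qed.

Lemma homMn x n : f (x *+ n) = f x *+ n.
Proof. by elim: n => [|n IHn]; rewrite ?hom0 // !mulrS homD IHn. Qed.

Lemma homMz x (c : int) : f (x *~ c) = f x *~ c.
Proof. by case: c => n; rewrite ?homMn // NegzE !mulrNz homN homMn. Qed.

Lemma hom_sum (J : Type) (s : seq J) (P : pred J) (F : J -> A) :
  f (\sum_(j <- s | P j) F j) = \sum_(j <- s | P j) f (F j).
Proof. exact: (big_morph _ homD hom0). Qed.

End Hom.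

Section SetoidQuotient.
Variables (T : Type) (zero : T) (opp : T -> T) (add : T -> T -> T).
Variable R : T -> T -> Prop.
Hypotheses (Rrefl : forall x, R x x) (Rsym : forall x y, R x y -> R y x)
  (Rtrans : forall x y z, R x y -> R y z -> R x z).
Hypotheses (Radd : forall x x' y y', R x x' -> R y y' -> R (add x y) (add x' y'))
  (Ropp : forall x x', R x x' -> R (opp x) (opp x')).
Hypotheses (RaddA : forall x y z, R (add x (add y z)) (add (add x y) z))
  (RaddC : forall x y, R (add x y) (add y x))
  (Radd0 : forall x, R (add zero x) x)
  (RaddN : forall x, R (add (opp x) x) zero).

(** The group laws are assumed only up to [R], because terms, to which this is applied later, form a
    group only modulo an equality. Elements of the quotient are the predicates [R x]. *)
Lemma setoid_zmod : exists (Q : zmodType) (pi : T -> Q),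
  [/\ forall q, exists x, pi x = q,
      forall x y, pi x = pi y <-> R x y,
      pi zero = 0,
      {morph pi : x y / add x y >-> x + y}
    & {morph pi : x / opp x >-> - x}].
Proof.
pose Q0 := {c : T -> Prop | exists x, c = R x}.
pose cl x : Q0 := exist _ (R x) (ex_intro _ x erefl).
have clP x y : cl x = cl y <-> R x y.
  split=> [/(congr1 sval) /= e|Rxy]; first by rewrite e.
  apply: eq_exist; apply/funext => z; apply/propext.
  by split=> [/(Rtrans (Rsym Rxy))|/(Rtrans Rxy)].
have clS q : {x | cl x = q}.
  apply: cid; case: q => c [x ex]; exists x.
  by apply: eq_exist.
pose rep q := sval (clS q).
have repK q : cl (rep q) = q by rewrite /rep; case: (clS q).
have Rrep x : R (rep (cl x)) x by apply/clP.
pose addq p q := cl (add (rep p) (rep q)).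
pose oppq p := cl (opp (rep p)).
have addE x y : cl (add x y) = addq (cl x) (cl y).
  by apply/clP; apply: Radd; apply: Rsym.
have oppE x : cl (opp x) = oppq (cl x).
  by apply/clP; apply: Ropp; apply: Rsym.
have qA : associative addq.
  by move=> p q r; rewrite -(repK p) -(repK q) -(repK r) -!addE; apply/clP.
have qC : commutative addq.
  by move=> p q; rewrite -(repK p) -(repK q) -!addE; apply/clP.
have q0 : left_id (cl zero) addq.
  by move=> p; rewrite -(repK p) -!addE; apply/clP.
have qN : left_inverse (cl zero) oppq addq.
  by move=> p; rewrite -(repK p) -oppE -!addE; apply/clP.
pose Qc : choiceType := HB.pack Q0 (gen_eqMixin Q0) (gen_choiceMixin Q0).
pose Q : zmodType := HB.pack Q0 Qc (GRing.isZmodule.Build Qc qA qC q0 qN).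
exists Q, cl; split=> //; move=> q; exists (rep q); exact: repK.
Qed.

End SetoidQuotient.

Lemma hom_of_morphs (A B : zmodType) (f : A -> B) :
  {morph f : x y / x + y} -> {morph f : x / - x} -> hom f.
Proof. by move=> fD fN x y; rewrite fD fN. Qed.

Lemma quotient_exists (A : zmodType) (H : A -> Prop) : subgroup H ->
  exists (Q : zmodType) (pi : A -> Q),
    [/\ hom pi, forall q, exists x, pi x = q & forall x, pi x = 0 <-> H x].
Proof.
move=> [H0 HB].
have HN x : H x -> H (- x) by move=> Hx; rewrite -sub0r; apply: HB.
have HD x y : H x -> H y -> H (x + y).
  by move=> Hx Hy; rewrite -(opprK y); apply: HB => //; apply: HN.
have eqH x y : x = y -> H (x - y) by move->; rewrite subrr.
have [|||||||||Q [pi [piS piP pi0 piD piN]]] :=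
  @setoid_zmod A 0 -%R +%R (fun x y => H (x - y)).
- by move=> x; apply: eqH.
- by move=> x y /HN; rewrite opprB.
- by move=> x y z Hxy Hyz; rewrite -(subrKA y); apply: HD.
- by move=> x x' y y' Hx Hy; rewrite opprD addrACA; apply: HD.
- by move=> x x' /HN; rewrite opprD.
- by move=> x y z; apply: eqH; rewrite addrA.
- by move=> x y; apply: eqH; rewrite addrC.
- by move=> x; apply: eqH; rewrite add0r.
- by move=> x; apply: eqH; rewrite addNr.
exists Q, pi; split=> //; first exact: hom_of_morphs.
by move=> x; rewrite -pi0 piP subr0.
Qed.

Lemma kernel_exists (A B : zmodType) (f : A -> B) : hom f ->
  exists (K : zmodType) (i : K -> A),
    [/\ hom i, injective i & forall x, f x = 0 <-> exists a, i a = x].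
Proof.
move=> hf.
pose K0 := {x : A | f x == 0}.
have k0 : f 0 == 0 by rewrite (hom0 hf).
have kD (x y : K0) : f (val x + val y) == 0.
  by rewrite (homD hf) (eqP (valP x)) (eqP (valP y)) addr0.
have kN (x : K0) : f (- val x) == 0 by rewrite (homN hf) (eqP (valP x)) oppr0.
pose kin x (fx : f x == 0) : K0 := exist _ x fx.
pose addk x y := kin _ (kD x y).
pose oppk x := kin _ (kN x).
have kA : associative addk by move=> x y z; apply: val_inj; rewrite /= addrA.
have kC : commutative addk by move=> x y; apply: val_inj; rewrite /= addrC.
have k0' : left_id (kin 0 k0) addk.
  by move=> x; apply: val_inj; rewrite /= add0r.
have kN' : left_inverse (kin 0 k0) oppk addk.
  by move=> x; apply: val_inj; rewrite /= addNr.
pose K : zmodType := HB.pack K0 (GRing.isZmodule.Build K0 kA kC k0' kN').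
exists K, (fun x : K0 => val x); split=> //.
move=> x; split=> [/eqP fx|[a <-]]; first by exists (kin x fx).
exact/eqP/(valP a).
Qed.

(** * Finite integer combinations of a sequence *)

Section LinearCombination.
Variable Y : zmodType.
Implicit Types (u v : nat -> Y) (d e : {poly int}).

(** A polynomial serves as a finitely supported integer sequence: [{poly int}] is the free group on
    the ['X^j], and [lin u] is its homomorphism sending ['X^j] to [u j]. *)
Definition lin u d : Y := \sum_(j < size d) u j *~ d`_j.

Lemma lin_widen u d N : (size d <= N)%N -> lin u d = \sum_(j < N) u j *~ d`_j.
Proof.
move=> leN; rewrite /lin (big_ord_widen N (fun j => u j *~ d`_j)) // big_mkcond.
apply: eq_bigr => j _; case: ltnP => // lej.
by rewrite nth_default.
Qed.

Lemma lin_hom u : hom (lin u).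
Proof.
move=> d e; pose N := maxn (size d) (size e).
have leN: (size (d - e)%R <= N)%N.
  by apply: leq_trans (size_polyD _ _) _; rewrite size_polyN.
rewrite (lin_widen _ leN) (@lin_widen _ d N) ?leq_maxl //.
rewrite (@lin_widen _ e N) ?leq_maxr // -sumrB; apply: eq_bigr => j _.
by rewrite coefB mulrzBr.
Qed.

Lemma linXn u j : lin u 'X^j = u j.
Proof.
rewrite /lin size_polyXn (bigD1 ord_max) //= coefXn eqxx mulr1z big1 ?addr0 //.
move=> i; rewrite -val_eqE /= => /negPf ne.
by rewrite coefXn ne mulr0z.
Qed.

Lemma eq_lin u v d : u =1 v -> lin u d = lin v d.
Proof. by move=> e; apply: eq_bigr => j _; rewrite e. Qed.

Lemma lin_subl u v d : lin (fun j => u j - v j) d = lin u d - lin v d.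
Proof. by rewrite /lin -sumrB; apply: eq_bigr => j _; rewrite mulrzBl. Qed.

Lemma lin0 d : lin (fun=> 0) d = 0.
Proof. by rewrite /lin big1 // => j _; rewrite mul0rz. Qed.

End LinearCombination.

Lemma hom_lin (A B : zmodType) (f : A -> B) (u : nat -> A) d :
  hom f -> f (lin u d) = lin (f \o u) d.
Proof.
by move=> hf; rewrite /lin hom_sum //; apply: eq_bigr => j _; rewrite homMz.
Qed.

Lemma lin_comp (Y : zmodType) (u : nat -> Y) (r : nat -> {poly int}) e :
  lin u (lin r e) = lin (fun m => lin u (r m)) e.
Proof. by rewrite (hom_lin _ _ (lin_hom u)). Qed.

Lemma lin_polyXn (d : {poly int}) : lin (fun j => 'X^j) d = d.
Proof.
rewrite -[RHS]coefK poly_def; apply: eq_bigr => j _.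
by rewrite mulpz intz.
Qed.

(** * Presentations, and Ext as solvability of linear systems *)

Definition presents (G : zmodType) (r : nat -> {poly int}) : Prop :=
  exists u : nat -> G, (forall g, exists d, lin u d = g) /\
    (forall d, lin u d = 0 <-> exists e, d = lin r e).

Definition independent (r : nat -> {poly int}) : Prop :=
  forall e, lin r e = 0 -> e = 0.

(** Independent relators give a free resolution of length one of the presented group; this is
    surjectivity of the induced map on homomorphisms into [Y], whose cokernel is Ext. *)
Definition solvable (r : nat -> {poly int}) (Y : zmodType) : Prop :=
  forall z : nat -> Y, exists u : nat -> Y, forall m, lin u (r m) = z m.

(* The system need only be solved in the kernel: correct arbitrary lifts of a
   solution in the quotient. *)
Lemma solve_lift (Y E H : zmodType) (i : Y -> E) (q : E -> H) r
    (w : nat -> H) (z : nat -> E) : ses i q -> solvable r Y ->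
  (forall m, lin w (r m) = q (z m)) ->
  exists u : nat -> E, (forall j, q (u j) = w j) /\
    forall m, lin u (r m) = z m.
Proof.
move=> [hi hq injI surq exq] solY wz.
have [u' u'P] := choice (fun j => surq (w j)).
have dz m : exists y, i y = lin u' (r m) - z m.
  apply/exq; rewrite hq (hom_lin _ _ hq) -wz; apply/eqP.
  by rewrite subr_eq0; apply/eqP/eq_lin => j /=.
have [y yP] := choice dz.
have [v vP] := solY y.
exists (fun j => u' j - i (v j)); split=> [j|m].
  by rewrite hq u'P (_ : q (i _) = 0) ?subr0 //; apply/exq; exists (v j).
by rewrite lin_subl -[lin (fun j => i _) _]hom_lin // vP yP opprB addrC subrK.
Qed.

Section ExtOfPresentation.
Variables (G : zmodType) (r : nat -> {poly int}).
Hypothesis Gr : presents G r.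

(** Lifting the generators so that the relators still vanish defines a section. *)
Lemma solvable_Ext0 (Y : zmodType) : solvable r Y -> Ext0 G Y.
Proof.
move=> solY E i q S; have [hi hq injI surq exq] := S.
have [u [uS uK]] := Gr.
have [|w [wq wr]] := @solve_lift _ _ _ i q r u (fun=> 0) S solY.
  by move=> m; rewrite (hom0 hq); apply/uK; exists 'X^m; rewrite linXn.
have [d dP] := choice uS.
(* [lin w] kills whatever [lin u] kills, so the choice of the preimage [d] does not matter. *)
have wE c : lin w c = lin w (d (lin u c)).
  apply/eqP; rewrite -subr_eq0 -lin_hom.
  have /uK [e ->] : lin u (c - d (lin u c)) = 0 by rewrite lin_hom dP subrr.
  by rewrite lin_comp (eq_lin _ wr) lin0.
exists (fun g => lin w (d g)); split=> [x y|x].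
  by rewrite -{1}(dP x) -{1}(dP y) -(lin_hom u) -wE (lin_hom w).
by rewrite (hom_lin _ _ hq) -{2}(dP x); apply: eq_lin.
Qed.

(* The extension to split is the pushout of [lin r] along [lin z]. *)
Lemma Ext0_solvable (Y : zmodType) : independent r -> Ext0 G Y -> solvable r Y.
Proof.
move=> indr ext z; have [u [uS uK]] := Gr.
pose A : zmodType := (Y * {poly int})%type.
pose H (x : A) := exists e, x.1 = - lin z e /\ x.2 = lin r e.
have sH : subgroup H.
  split; first by exists 0; rewrite !(hom0 (lin_hom _)) oppr0.
  move=> x y [e [x1 x2]] [f [y1 y2]]; exists (e - f).
  by rewrite !lin_hom /= x1 x2 y1 y2 opprB opprK addrC.
have [E [pi [hpi piS piK]]] := quotient_exists sH.
have [rep repP] := choice piS.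
pose i (y : Y) := pi (y, 0).
pose q (t : E) : G := lin u (rep t).2.
have qpi x : q (pi x) = lin u x.2.
  apply/eqP; rewrite -subr_eq0 -lin_hom; apply/eqP/uK.
  have /piK [e [_ e2]] : pi (rep (pi x) - x) = 0 by rewrite hpi repP subrr.
  by exists e; rewrite -e2.
have hi : hom i.
  by move=> x y; rewrite /i -hpi -{1}(subrr (0 : {poly int})).
(* Independence enters here: an element of [H] with zero second component comes from [e = 0]. *)
have inji : injective i.
  move=> x y /eqP; rewrite -subr_eq0 -hi => /eqP/piK [e [/= e1 e2]].
  have e0 := indr e (esym e2); move: e1; rewrite e0 (hom0 (lin_hom _)).
  by rewrite oppr0 => /eqP; rewrite subr_eq0 => /eqP.
have hq : hom q.
  by move=> x y; rewrite -(repP x) -(repP y) -hpi !qpi lin_hom.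
have S : ses i q.
  split=> // [g|t].
    by have [d dP] := uS g; exists (pi (0, d)); rewrite qpi.
  split=> [|[y <-]]; last by rewrite qpi (hom0 (lin_hom _)).
  rewrite -(repP t) qpi => /uK [e eP]; exists ((rep t).1 + lin z e).
  apply/eqP; rewrite -subr_eq0 -hpi; apply/eqP/piK; exists (- e).
  rewrite !(homN (lin_hom _)) opprK /= eP sub0r; split=> //.
  by rewrite addrAC subrr add0r.
have [s [hs qs]] := ext E i q S.
have [_ _ _ _ exq] := S.
(* In [E] the lifts [pi (0, 'X^j)] of the generators turn relator [r m] into [i (z m)], whereas the
   lifts [s (u j)] make it vanish; their difference solves the system. *)
have yP j : exists y, i y = pi (0, 'X^j) - s (u j).
  by apply/exq; rewrite hq qpi qs linXn subrr.
have [v vP] := choice yP; exists v => m.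
apply: inji; rewrite (hom_lin _ _ hi) (eq_lin _ vP) lin_subl.
rewrite -[lin (fun j => s (u j)) _](hom_lin _ _ hs).
have -> : lin u (r m) = 0 by apply/uK; exists 'X^m; rewrite linXn.
have hp : hom (fun d => pi (0, d)).
  by move=> d e; rewrite -hpi -{1}(subrr (0 : Y)).
rewrite (hom0 hs) subr0 -[lin _ _](hom_lin _ _ hp).
rewrite lin_polyXn; apply/eqP; rewrite -subr_eq0 -hpi; apply/eqP/piK.
exists 'X^m; rewrite !linXn; split=> /=; first by rewrite sub0r.
by rewrite subr0.
Qed.

End ExtOfPresentation.

(** * Term algebra and special precovers *)

Inductive term (A : Type) : Type :=
| Gen of A
| Zero
| Add of term A & term A
| Opp of term A
| Sol of (nat -> {poly int}) & (nat -> term A) & nat.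

Section SpecialPrecover.
Variables (V : (nat -> {poly int}) -> Prop) (G : zmodType).
Notation T := (term G).

Fixpoint tval (t : T) : G :=
  match t with
  | Gen g => g
  | Zero => 0
  | Add t1 t2 => tval t1 + tval t2
  | Opp t1 => - tval t1
  | Sol _ _ _ => 0
  end.

Definition additive_model (E : zmodType) (f : T -> E) : Prop :=
  [/\ f (Zero G) = 0, forall x y, f (Add x y) = f x + f y
    & forall x, f (Opp x) = - f x].

(** With equations imposed only for these right-hand sides, [tval] is a model although it sends
    every [Sol] node to zero. *)
Definition null (z : nat -> T) : Prop := forall m, tval (z m) = 0.

Definition model (E : zmodType) (f : T -> E) : Prop :=
  additive_model f /\ forall r z, V r -> null z ->
    forall m, lin (fun j => f (Sol r z j)) (r m) = f (z m).

(** The intersection of the kernels of all models takes the place of an inductively generated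
    congruence. *)
Definition teq (s t : T) : Prop :=
  forall (E : zmodType) (f : T -> E), model f -> f s = f t.

(** Terms are not a group before the quotient is taken, so [lin] cannot be formed on them; the term
    found here stands for it in every additive model. *)
Lemma lin_term (u : nat -> T) (d : {poly int}) :
  exists t : T, forall (E : zmodType) (f : T -> E),
    additive_model f -> f t = lin (f \o u) d.
Proof.
have smul (s : T) (c : int) : exists t : T, forall (E : zmodType) (f : T -> E),
    additive_model f -> f t = f s *~ c.
  have nmul n : exists t : T, forall (E : zmodType) (f : T -> E),
      additive_model f -> f t = f s *+ n.
    elim: n => [|n [t tP]]; first by exists (Zero G) => E f [].
    by exists (Add s t) => E f fA; have [_ fD _] := fA; rewrite fD tP // mulrS.
  case: c => n; first by have [t tP] := nmul n; exists t.
  have [t tP] := nmul n.+1; exists (Opp t) => E f fA.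
  by have [_ _ fN] := fA; rewrite fN tP.
have sums (N : nat) : exists t : T, forall (E : zmodType) (f : T -> E),
    additive_model f -> f t = \sum_(j < N) f (u j) *~ d`_j.
  elim: N => [|N [t tP]].
    by exists (Zero G) => E f [f0 _ _]; rewrite big_ord0.
  have [t' t'P] := smul (u N) d`_N; exists (Add t t') => E f fA.
  by have [_ fD _] := fA; rewrite fD tP // t'P // big_ord_recr.
exact: sums.
Qed.

Lemma tval_model : model tval.
Proof. by split=> // r z _ nz m; rewrite lin0 nz. Qed.

Lemma universal_model : exists (P : zmodType) (pi : T -> P),
  [/\ model pi, forall p, exists t, pi t = p
    & forall s t, pi s = pi t <-> teq s t].
Proof.
have [|||||||||P [pi [piS piP pi0 piD piN]]] :=
  @setoid_zmod T (Zero G) (@Opp G) (@Add G) teq.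
- by move=> x E f _.
- by move=> x y h E f mf; rewrite h.
- by move=> x y z h h' E f mf; rewrite h // h'.
- by move=> x x' y y' h h' E f mf; have [[_ fD _] _] := mf; rewrite !fD h // h'.
- by move=> x x' h E f mf; have [[_ _ fN] _] := mf; rewrite !fN h.
- by move=> x y z E f [[_ fD _] _]; rewrite !fD addrA.
- by move=> x y E f [[_ fD _] _]; rewrite !fD addrC.
- by move=> x E f [[f0 fD _] _]; rewrite fD f0 add0r.
- by move=> x E f [[f0 fD fN] _]; rewrite fD fN f0 addNr.
exists P, pi; split=> //; split=> // r z Vr nz m.
(* Once the left side is the image of a single term, [piP] reduces the equation to arbitrary models,
   where it holds by definition. *)
have [t tP] := lin_term (Sol r z) (r m).
rewrite -[LHS](tP P pi) //; apply/piP => E f [fA fS].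
by rewrite tP //; apply: fS.
Qed.

Section Universal.
Variables (P : zmodType) (pi : T -> P).
Hypotheses (mpi : model pi) (piS : forall p, exists t, pi t = p)
  (piP : forall s t, pi s = pi t <-> teq s t).

Lemma model_factor (E : zmodType) (f : T -> E) : model f ->
  exists2 h : P -> E, hom h & forall t, h (pi t) = f t.
Proof.
move=> mf; have [rep repP] := choice piS.
have fE t : f (rep (pi t)) = f t by have /piP := repP (pi t); apply.
exists (f \o rep) => //= x y.
have [[_ fD fN] _] := mf; have [[_ pD pN] _] := mpi.
by rewrite -{1}(repP x) -{1}(repP y) -pN -pD /= fE fD fN.
Qed.

(* The section is built by recursion on terms, solving one system in [Y] at
   each [Sol] node; this replaces the transfinite filtration of [P]. *)
Lemma universal_Ext0 (Y : zmodType) :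
  (forall r, V r -> solvable r Y) -> Ext0 P Y.
Proof.
move=> solY E i q S; have [hi hq _ surq _] := S.
have [[p0 pD pN] pS] := mpi.
have step r (z : nat -> T) (w : nat -> E) : (forall m, q (w m) = pi (z m)) ->
    {u : nat -> E | (forall j, q (u j) = pi (Sol r z j)) /\
      (V r -> null z -> forall m, lin u (r m) = w m)}.
  move=> wP; apply: cid.
  (* Where no equation is imposed, arbitrary lifts serve. *)
  have [[Vr nz]|nVz] := pselect (V r /\ null z).
    have [|u [uq ur]] :=
      solve_lift (w := fun j => pi (Sol r z j)) (z := w) S (solY r Vr).
      by move=> m; rewrite wP pS.
    by exists u.
  have [u uP] := choice (fun j => surq (pi (Sol r z j))).
  by exists u; split=> // Vr nz; case: nVz.
have gen g : {e | q e = pi (Gen g)} by apply: cid; apply: surq.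
have q0 : q 0 = pi (Zero G) by rewrite p0 (hom0 hq).
have qD x y ex ey : q ex = pi x -> q ey = pi y -> q (ex + ey) = pi (Add x y).
  by move=> hx hy; rewrite (homD hq) hx hy pD.
have qN x ex : q ex = pi x -> q (- ex) = pi (Opp x).
  by move=> hx; rewrite (homN hq) hx pN.
(* Each value is paired with the proof that it lifts the image of its term; the [Sol] case needs
   this for its subterms. *)
pose s := fix s (t : T) : {e | q e = pi t} :=
  match t with
  | Gen g => gen g
  | Zero => exist _ 0 q0
  | Add x y => exist _ _ (qD _ _ _ _ (svalP (s x)) (svalP (s y)))
  | Opp x => exist _ _ (qN _ _ (svalP (s x)))
  | Sol r z j =>
      (* [u] does not depend on [j], so all nodes [Sol r z j] take their values from one
         solution. *)
      let u := step r z (fun m => sval (s (z m))) (fun m => svalP (s (z m))) in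
      exist _ (sval u j) ((svalP u).1 j)
  end.
have ms : model (fun t => sval (s t)).
  split=> // r z Vr nz m /=.
  exact: (svalP (step r z _ _)).2.
have [h hh hP] := model_factor ms.
exists h; split=> // x; have [t <-] := piS x.
by rewrite hP; apply: (svalP (s t)).
Qed.

(** A sequence in the kernel is represented by a null sequence of terms; its [Sol] nodes have value
    zero and hence solve the system inside the kernel. *)
Lemma universal_kernel : exists (K : zmodType) (i : K -> P) (q : P -> G),
  ses i q /\ forall r, V r -> solvable r K.
Proof.
have [q hq qP] := model_factor tval_model.
have [K [i [hi inji iP]]] := kernel_exists hq.
exists K, i, q; split.
  by split=> // g; exists (pi (Gen g)); rewrite qP.
move=> r Vr z; have [zt ztP] := choice (fun m => piS (i (z m))).
have nz : null zt by move=> m; rewrite -qP ztP; apply/iP; exists (z m).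
have solK j : exists k, i k = pi (Sol r zt j) by apply/iP; rewrite qP.
have [u uP] := choice solK; exists u => m.
apply: inji; rewrite (hom_lin _ _ hi) (eq_lin _ uP) -ztP.
by have [_ ->] := mpi.
Qed.

End Universal.

Lemma special_precover : exists (K P : zmodType) (i : K -> P) (q : P -> G),
  [/\ ses i q, forall r, V r -> solvable r K
    & forall Y : zmodType, (forall r, V r -> solvable r Y) -> Ext0 P Y].
Proof.
have [P [pi [mpi piS piP]]] := universal_model.
have [K [i [q [S solK]]]] := universal_kernel mpi piS piP.
by exists K, P, i, q; split=> // Y; apply: (universal_Ext0 mpi piS piP).
Qed.

End SpecialPrecover.

(** * Extensions and pullbacks *)

Lemma solvable_extension (Y E H : zmodType) (i : Y -> E) (q : E -> H) r :
  ses i q -> solvable r Y -> solvable r H -> solvable r E.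
Proof.
move=> S solY solH z; have [w wP] := solH (fun m => q (z m)).
by have [u [_ uP]] := solve_lift S solY wP; exists u.
Qed.

(** Any group isomorphic to the fibre product qualifies; the description is symmetric in the two
    projections. *)
Definition pullback (D P Q C : zmodType) (a : D -> Q) (b : P -> Q)
    (c1 : C -> D) (c2 : C -> P) : Prop :=
  [/\ hom c1, hom c2, forall x y, c1 x = c1 y -> c2 x = c2 y -> x = y
    & forall d p, a d = b p <-> exists c, c1 c = d /\ c2 c = p].

Lemma pullback_exists (D P Q : zmodType) (a : D -> Q) (b : P -> Q) :
  hom a -> hom b ->
  exists (C : zmodType) (c1 : C -> D) (c2 : C -> P), pullback a b c1 c2.
Proof.
move=> ha hb.
have hf : hom (fun x : (D * P)%type => a x.1 - b x.2).
  move=> x y; transitivity (a x.1 - a y.1 - (b x.2 - b y.2)).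
    by rewrite -ha -hb.
  by rewrite !opprB [LHS]addrACA [RHS]addrACA [- b _ - _]addrC.
have [C [i [hi inji iP]]] := kernel_exists hf.
exists C, (fun c => (i c).1), (fun c => (i c).2); split.
- by move=> x y; rewrite hi.
- by move=> x y; rewrite hi.
- move=> x y e1 e2; apply: inji.
  by rewrite [LHS]surjective_pairing [RHS]surjective_pairing e1 e2.
move=> d p; have := iP (d, p); rewrite /= => iP'.
split=> [e|[c [ed ep]]].
  have [c cE] : exists c, i c = (d, p) by apply/iP'; rewrite e subrr.
  by exists c; rewrite cE.
apply/eqP; rewrite -subr_eq0; apply/eqP/iP'; exists c.
by rewrite [LHS]surjective_pairing ed ep.
Qed.

Lemma pullback_sym (D P Q C : zmodType) (a : D -> Q) (b : P -> Q)
    (c1 : C -> D) (c2 : C -> P) : pullback a b c1 c2 -> pullback b a c2 c1.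
Proof.
move=> [h1 h2 inj12 ab]; split=> // [x y e2 e1|p d]; first exact: inj12.
by split=> [/esym/ab|] [c [? ?]]; [exists c | apply/esym/ab; exists c].
Qed.

(** Pulling back a surjection keeps its kernel: [k x] is the point lying over [0] and [j x]. *)
Lemma pullback_ses (K D P Q C : zmodType) (j : K -> P) (a : D -> Q) (b : P -> Q)
    (c1 : C -> D) (c2 : C -> P) :
  hom a -> pullback a b c1 c2 -> ses j b -> exists k : K -> C, ses k c1.
Proof.
move=> ha [h1 h2 inj12 ab] [hj hb injj surb exb].
have jP x : exists c, c1 c = 0 /\ c2 c = j x.
  by apply/ab; rewrite (hom0 ha); apply/esym/exb; exists x.
have [k kP] := choice jP; exists k; split=> //.
- move=> x y; apply: inj12.
    by rewrite h1 !(kP _).1 subr0.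
  by rewrite h2 !(kP _).2 hj.
- by move=> x y e; apply: injj; rewrite -!(kP _).2 e.
- move=> d; have [p pP] := surb (a d).
  by have /ab [c [? _]] := esym pP; exists c.
move=> c; split=> [c0|[x <-]]; last exact: (kP x).1.
have : a (c1 c) = b (c2 c) by apply/ab; exists c.
rewrite c0 (hom0 ha) => /esym/exb [x xP]; exists x.
by apply: inj12; rewrite ?c0 ?(kP x).1 ?(kP x).2.
Qed.

(** * Divisible hulls *)

Definition divisible (D : zmodType) : Prop :=
  forall (x : D) (c : int), c != 0 -> exists y, y *~ c = x.

Section DivisibleHull.
Variable G : zmodType.
Implicit Types (s : seq G) (c : G -> int).

Lemma sum_subset s s' c : uniq s -> uniq s' -> {subset s <= s'} ->
  (forall g, g \notin s -> c g = 0) ->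
  \sum_(g <- s') g *~ c g = \sum_(g <- s) g *~ c g.
Proof.
move=> us us' ss' c0.
have ps : perm_eq s [seq g <- s' | g \in s].
  apply: uniq_perm; rewrite ?filter_uniq // => g; rewrite mem_filter.
  by case: (boolP (g \in s)) => // /ss' ->.
rewrite (perm_big _ ps) big_filter [RHS]big_mkcond; apply: eq_bigr => g _.
by case: ifPn => // /c0 ->.
Qed.

Lemma sum_pred1 s x : uniq s -> x \in s -> \sum_(g <- s) g *~ (g == x)%:R = x.
Proof.
move=> us xs; rewrite (bigD1_seq x) //= eqxx mulr1z big1 ?addr0 // => g.
by move/negPf->.
Qed.

(* [rat ^ G] is divisible and [G] sits in it modulo the integral relations of
   the canonical presentation of [G]. *)
Definition int_relation (f : G -> rat) : Prop := exists s c,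
  [/\ uniq s, forall g, f g = (c g)%:~R, forall g, g \notin s -> c g = 0
    & \sum_(g <- s) g *~ c g = 0].

Lemma int_relation_subgroup : subgroup int_relation.
Proof.
split; first by exists [::], (fun=> 0); rewrite big_nil.
move=> f f' [s [c [us fc c0 sc]]] [s' [c' [us' fc' c0' sc']]].
exists (undup (s ++ s')), (fun g => c g - c' g); split.
- exact: undup_uniq.
- by move=> g; rewrite intrB -fc -fc'.
- by move=> g; rewrite mem_undup mem_cat negb_or => /andP [/c0-> /c0'->].
under eq_bigr do rewrite mulrzBr.
rewrite sumrB (@sum_subset s _ c) ?(@sum_subset s' _ c') ?undup_uniq 
  ?sc ?sc' ?subr0 //;
  by move=> g gs; rewrite mem_undup mem_cat gs ?orbT.
Qed.

Lemma divisible_hull : exists (D : zmodType) (i : G -> D),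
  [/\ hom i, injective i & divisible D].
Proof.
have [D [pi [hpi piS piK]]] := quotient_exists int_relation_subgroup.
pose delta (x : G) : G -> rat := fun g => (g == x)%:R.
have hi : hom (pi \o delta).
  move=> x y /=; apply/eqP; rewrite -subr_eq0 -!hpi; apply/eqP/piK.
  pose s := undup [:: x - y; x; y].
  exists s, (fun g => (g == x - y)%:R - ((g == x)%:R - (g == y)%:R)); split.
  - exact: undup_uniq.
  - by move=> g; rewrite !intrB !mulrz_nat.
  - move=> g; rewrite mem_undup !inE !negb_or => /and3P [].
    by move=> /negPf-> /negPf-> /negPf->.
  under eq_bigr do rewrite !mulrzBr.
  by rewrite !sumrB !sum_pred1 ?undup_uniq ?mem_undup ?inE ?eqxx ?orbT ?subrr.
exists D, (pi \o delta); split=> // [x y /eqP|x c c0].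
  rewrite -subr_eq0 -hi => /eqP /piK [s [c [us fc c0 sc]]].
  (* The relation found is the single generator [x - y] with coefficient 1, so its vanishing sum is
     [x - y]. *)
  have cE g : c g = (g == x - y)%:R.
    by apply/eqP; rewrite -(eqr_int rat) -fc mulrz_nat.
  apply/eqP; rewrite -subr_eq0; apply/eqP; rewrite -[RHS]sc.
  rewrite -[LHS](@sum_pred1 s) //; first by apply: eq_bigr => g _; rewrite cE.
  by apply/negPn/negP => /c0; rewrite cE eqxx.
have [f <-] := piS x; exists (pi (fun g => f g / c%:~R)).
rewrite -homMz //; congr pi; apply/funext => g.
have hev : hom (fun h : G -> rat => h g) by [].
rewrite (homMz hev) -mulrzr divfK // intr_eq0 //.
Qed.

End DivisibleHull.

(** * Presentations of finite-rank-free-by-1 groups *)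

Section FreeByOne.
Variables (n : nat) (p : nat -> int) (k : 'I_n -> nat -> int).

(* The basis of [B] is encoded as [x_i = 'X^i] and [y_m = 'X^(n + m)]. *)
Definition relator (m : nat) : {poly int} :=
  'X^(n + m.+1) *~ p m - 'X^(n + m) - \sum_(i < n) 'X^i *~ k i m.

Lemma lin_relator (Y : zmodType) (u : nat -> Y) m :
  lin u (relator m) =
    u (n + m.+1)%N *~ p m - u (n + m)%N - \sum_(i < n) u i *~ k i m.
Proof.
rewrite /relator !lin_hom (homMz (lin_hom u)) (hom_sum (lin_hom u)) !linXn.
by congr (_ - _); apply: eq_bigr => i _; rewrite (homMz (lin_hom u)) linXn.
Qed.

Lemma coef_hom j : hom (fun d : {poly int} => d`_j).
Proof. by move=> x y; rewrite coefB. Qed.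

Lemma lin_delta (e : {poly int}) j : lin (fun m => (j == m)%:R) e = e`_j.
Proof.
rewrite -[in RHS](lin_polyXn e) (hom_lin _ _ (coef_hom j)).
by apply: eq_lin => m; rewrite /= coefXn.
Qed.

(** This formula and the one for the [y_j] below match the two coefficient conditions in [inN]. *)
Lemma coef_relator_x (e : {poly int}) (i : 'I_n) N : (size e <= N)%N ->
  (lin relator e)`_i = - \sum_(m < N) e`_m * k i m.
Proof.
have hc := coef_hom i.
have rE m : (relator m)`_i = - k i m.
  rewrite /relator !coefB (homMz hc) (hom_sum hc) !coefXn.
  rewrite !ltn_eqF ?ltn_addr // (bigD1 i) //= big1 => [|i' ne].
    by rewrite (homMz hc) coefXn eqxx mul0rz subr0 addr0 sub0r intz.
  by rewrite (homMz hc) coefXn val_eqE eq_sym (negPf ne) mul0rz.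
move=> leN; rewrite (hom_lin _ _ hc) (lin_widen _ leN) -sumrN.
by apply: eq_bigr => m _; rewrite /= rE mulNrz -mulrzr intz mulrC.
Qed.

Lemma coef_relator_y (e : {poly int}) j :
  (lin relator e)`_(n + j) = (if j is j'.+1 then e`_j' * p j' else 0) - e`_j.
Proof.
rewrite (hom_lin _ _ (coef_hom _)) /=.
have rE m : (relator m)`_(n + j) =
    (if j is j'.+1 then (j' == m)%:R * p j' else 0) - (j == m)%:R.
  rewrite /relator !coefB (homMz (coef_hom _)) (hom_sum (coef_hom _)).
  rewrite !coefXn !eqn_add2l big1 ?subr0 => [|i _].
    by case: j => [|j]; rewrite ?mul0rz // eqSS; case: eqP => [->|];
      rewrite ?mul0rz ?mul0r ?mul1r // -mulrzr mul1r intz.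
  by rewrite (homMz (coef_hom _)) coefXn gtn_eqF ?mul0rz // ltn_addr.
rewrite (eq_lin _ rE) lin_subl lin_delta; congr (_ - _).
case: j {rE} => [|j]; first exact: lin0.
have hp : hom (fun x : int => x * p j) by move=> x y; rewrite mulrBl.
by rewrite -[LHS](hom_lin _ _ hp) lin_delta.
Qed.

Hypothesis p0 : forall m, p m != 0.

(** The coefficient of [y_(j+1)] is [e_j p_j - e_(j+1)] and that of [y_0] is [- e_0], so the [e_j]
    vanish one after another. *)
Lemma relator_independent : independent relator.
Proof.
move=> e e0; apply/polyP => j; rewrite coef0; elim: j => [|j IHj].
  have := coef_relator_y e 0%N.
  by rewrite e0 coef0 => /(congr1 -%R); rewrite sub0r opprK oppr0.
have := coef_relator_y e j.+1; rewrite e0 coef0 IHj mul0r.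
by move/(congr1 -%R); rewrite sub0r opprK oppr0.
Qed.

(** Put all [x_i] and [y_0] equal to zero; the [m]-th equation then reads [y_(m+1) p_m = z_m + y_m]
    and is solved by dividing by [p_m]. *)
Lemma relator_solvable (D : zmodType) : divisible D -> solvable relator D.
Proof.
move=> divD z.
have [dv dvP] := choice (fun xm : D * nat => divD xm.1 _ (p0 xm.2)).
pose b := fix b m := if m is m'.+1 then dv (z m' + b m', m') else 0.
exists (fun j => if (j < n)%N then 0 else b (j - n)%N) => m.
rewrite lin_relator big1 => [|i _]; last by rewrite ltn_ord mul0rz.
rewrite !ltnNge !leq_addr /= !addKn /=.
by rewrite (dvP (z m + b m, m)) /= subr0 addrK.
Qed.

Lemma presented_presents (G : zmodType) : presented G p k -> presents G relator.
Proof.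
move=> [a [b [abS abK]]].
pose u j := if insub j is Some i then a i else b (j - n)%N.
have uE (q : {poly int}) M : (size q <= n + M)%N ->
    lin u q = evalB a b (fun i => q`_i) (fun j => q`_(n + j)) M.
  move=> leM; rewrite (lin_widen _ leM) big_split_ord /evalB /=.
  congr (_ + _); apply: eq_bigr => j _; rewrite /u.
    by rewrite valK.
  by rewrite insubN ?addKn // -leqNgt leq_addr.
exists u; split=> [g|q].
  have [c [d [M [dM <-]]]] := abS g.
  pose q := \poly_(j < n + M) (if insub j is Some i then c i else d (j - n)%N).
  exists q; rewrite (uE _ M) ?size_poly // /evalB; congr (_ + _);
    apply: eq_bigr => j _; rewrite coef_poly.
    by rewrite ltn_addr // valK.
  by rewrite ltn_add2l ltn_ord insubN ?addKn // -leqNgt leq_addr.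
rewrite (uE q (size q)) ?leq_addl // abK; last first.
  by move=> j lej; rewrite nth_default // (leq_trans lej) ?leq_addl.
split=> [[e [L [eL [ec ed]]]]|[e ->]].
  pose e' := \poly_(m < L) e m.
  have e'E m : e'`_m = e m by rewrite coef_poly; case: ltnP => // /eL.
  exists e'; apply/polyP => j; case: (ltnP j n) => [ltj|lej].
    rewrite (coef_relator_x (Ordinal ltj) (size_poly _ _)) (ec (Ordinal ltj)).
    by congr (- _); apply: eq_bigr => m _; rewrite e'E.
  rewrite -(subnKC lej) coef_relator_y ed e'E.
  by case: (j - n)%N => // j'; rewrite e'E.
exists (fun m => e`_m), (size e); split; first by move=> m; apply: nth_default.
split=> [i|j]; [exact: coef_relator_x | exact: coef_relator_y].
Qed.

End FreeByOne.

(* Phi is a set of groups, given as a family indexed by a type I *)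
Theorem theorem6p1 (I : Type) (Phi : I -> zmodType)
  (hPhi : forall i, fr_free_by_1 (Phi i)) :
  let X : gclass := fun G => exists i, Phi i = G in
  enough_projectives (cogenF X) (cogenC X) /\
  enough_injectives (cogenF X) (cogenC X).
Proof.
move=> X.
(* Presentation and independence serve to describe the right class; solvability in divisible groups
   serves for enough injectives. *)
pose V r := [/\ exists i, presents (Phi i) r, independent r
  & forall D, divisible D -> solvable r D].
have VP i : exists2 r, V r & presents (Phi i) r.
  have [n [p [k [p0 pres _ _]]]] := hPhi i.
  have pr := presented_presents pres; exists (relator p k) => //.
  split; [by exists i | exact: relator_independent | exact: relator_solvable].
have rperpP Y : rperp X Y <-> forall r, V r -> solvable r Y.
  split=> [XY r [[i Gr] indr _]|solY _ [i <-]].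
    by apply: (Ext0_solvable Gr indr); apply: XY; exists i.
  by have [r Vr Gr] := VP i; apply: solvable_Ext0 Gr _ (solY r Vr).
split=> G.
  have [K [P [i [q [S solK extP]]]]] := special_precover V G.
  exists K, P, i, q; split=> //; split; first exact/rperpP.
  by move=> Y /rperpP; apply: extP.
have [D [i [hi inji divD]]] := divisible_hull G.
have [|Q [a [ha aS aK]]] := @quotient_exists D (fun x => exists g, i g = x).
  split; first by exists 0; apply: hom0.
  by move=> _ _ [g <-] [h <-]; exists (g - h); apply: hi.
have Sa : ses i a by split.
have [K [P [j [b [Sb solK extP]]]]] := special_precover V Q.
have [_ hb _ _ _] := Sb.
(* The pullback yields [0 -> G -> C -> P -> 0] and [0 -> K -> C -> D -> 0]; the second puts [C] in
   the right class, since the systems are solvable in [K] and in [D]. *)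
have [C [c1 [c2 pb]]] := pullback_exists ha hb.
have [g Sg] := pullback_ses hb (pullback_sym pb) Sa.
have [k Sk] := pullback_ses ha pb Sb.
exists C, P, g, c2; split=> //; split.
  apply/rperpP => r Vr; apply: solvable_extension Sk (solK r Vr) _.
  by case: Vr => _ _; apply.
by move=> Y /rperpP; apply: extP.
Qed.
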